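(* Given any finite abelian group $G$, there is some $n$ and some arithmetical structure $(\mathbf{d},\mathbf{r})$ on the star graph $S_n$ such that $G\leq \mathcal{K}(S_n; \mathbf{d}, \mathbf{r})$, i.e. $G$ is isomorphic to a subgroup of $\mathcal{K}(S_n; \mathbf{d}, \mathbf{r})$.
   Context: An arithmetical structure on a finite, connected, loopless graph $H$ with vertex set $V(H)$ is a pair $(\mathbf{d},\mathbf{r})$, where $\mathbf{r}=(r_v)_{v\in V(H)}$ consists of positive integers with no common factor, $\mathbf{d}=(d_v)_{v\in V(H)}$ consists of nonnegative integers, and for every vertex $v$ we have $r_vd_v=\sum r_u$, the sum being over all $u$ adjacent to $v$ (with multiplicity for multigraphs). Its critical group $\mathcal{K}(H;\mathbf{d},\mathbf{r})$ is the torsion part of the cokernel (over $\mathbb{Z}$) of the matrix $\operatorname{diag}(\mathbf{d})-A(H)$, where $A(H)$ is the adjacency matrix of $H$. The star graph $S_n$ has $n$ leaves $v_1,\dotsc,v_n$, each joined by one edge to a central vertex $v_0$ (and no other edges). *)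

(* Defs.v *)
(* Classical logic ([boolp]) is used only to turn membership in the image of an
   integer matrix, and torsion, into boolean predicates. *)
From HB Require Import structures.
From mathcomp Require Import all_boot all_algebra.
From mathcomp Require Import boolp.

Set Implicit Arguments.
Unset Strict Implicit.
Unset Printing Implicit Defensive.

Import GRing.Theory.
Local Open Scope ring_scope.

(* [mg_mult H u v] is the number of edges between [u] and [v], so the matrix
   is the adjacency matrix A(H). *)
Record multigraph (n : nat) := Multigraph {
  mg_mult :> 'M[nat]_n;
  mg_nonempty : (0 < n)%N;
  mg_sym : forall u v, mg_mult u v = mg_mult v u;
  mg_loopless : forall v, mg_mult v v = 0%N;
  mg_connected : forall u v, connect (fun x y => (0 < mg_mult x y)%N) u v
}.

Record arithmetical_structure (n : nat) (H : multigraph n) :=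
  ArithmeticalStructure {
    as_d : 'I_n -> nat;
    as_r : 'I_n -> nat;
    as_r_gt0 : forall v, (0 < as_r v)%N;
    as_r_gcd : \big[gcdn/0%N]_v as_r v = 1%N;
    as_eq : forall v, (as_r v * as_d v = \sum_u H v u * as_r u)%N
  }.

Section Cokernel.
Variables (m n : nat) (L : 'M[int]_(m, n)).

Definition mx_image : {pred 'cV[int]_m} :=
  fun y => `[< exists x : 'cV[int]_n, y = L *m x >].

Lemma mx_image_zmod_closed : zmod_closed mx_image.
Proof.
split; first by apply/asboolP; exists 0; rewrite mulmx0.
move=> _ _ /asboolP[x ->] /asboolP[y ->]; apply/asboolP.
by exists (x - y); rewrite mulmxBr.
Qed.

HB.instance Definition _ :=
  GRing.isZmodClosed.Build 'cV[int]_m mx_image mx_image_zmod_closed.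

Definition cokernel : zmodType := Quotient.quot mx_image.

End Cokernel.

Section Torsion.
Variable M : zmodType.

Definition is_torsion : {pred M} :=
  fun x => `[< exists2 k : nat, (0 < k)%N & x *+ k = 0 >].

Lemma is_torsion_zmod_closed : zmod_closed is_torsion.
Proof.
split; first by apply/asboolP; exists 1%N; rewrite ?mul0rn.
move=> x y /asboolP[k k0 xk] /asboolP[l l0 yl]; apply/asboolP.
exists (k * l)%N; first by rewrite muln_gt0 k0.
by rewrite mulrnBl mulrnA xk mul0rn mulnC mulrnA yl mul0rn subrr.
Qed.

HB.instance Definition _ :=
  GRing.isZmodClosed.Build M is_torsion is_torsion_zmod_closed.

Record torsion_part : predArgType :=
  TorsionPart { torsion_val : M; _ : torsion_val \in is_torsion }.

HB.instance Definition _ := [isSub of torsion_part for torsion_val].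
HB.instance Definition _ := [Choice of torsion_part by <:].
HB.instance Definition _ := [SubChoice_isSubZmodule of torsion_part by <:].

End Torsion.

Definition structure_matrix (n : nat) (H : multigraph n)
    (s : arithmetical_structure H) : 'M[int]_n :=
  diag_mx (\row_v (as_d s v)%:Z) - map_mx Posz H.

Definition critical_group (n : nat) (H : multigraph n)
    (s : arithmetical_structure H) : zmodType :=
  torsion_part (cokernel (structure_matrix s)).

(* The centre [v_0] is [ord0]; the leaves [v_1, ..., v_n] are the other
   elements of ['I_n.+1]. *)
Definition star_mult (n : nat) : 'M[nat]_n.+1 :=
  \matrix_(u, v) ((u == ord0) != (v == ord0) : nat).

Lemma star_sym n u v : star_mult n u v = star_mult n v u.
Proof. by rewrite !mxE eq_sym. Qed.

Lemma star_loopless n v : star_mult n v v = 0%N.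
Proof. by rewrite mxE eqxx. Qed.

Lemma star_connected n u v :
  connect (fun x y => (0 < star_mult n x y)%N) u v.
Proof.
have to0 x : connect (fun x y => (0 < star_mult n x y)%N) x ord0.
  have [->|x0] := eqVneq x ord0; first exact: connect0.
  by apply: connect1; rewrite mxE (negPf x0) eqxx.
apply: connect_trans (to0 u) _; have [->|v0] := eqVneq v ord0.
  exact: connect0.
by apply: connect1; rewrite mxE (negPf v0) eqxx.
Qed.

Definition star_graph (n : nat) : multigraph n.+1 :=
  Multigraph (ltn0Sn n) (@star_sym n) (@star_loopless n) (@star_connected n).

(* Main.v *)
(* Take all leaf degrees of the star equal to [m = #|G|] and the number of
   leaves a multiple of [m].  In the critical group, the differences of two leaf
   generators are killed by [m] and satisfy only one more relation, so it is a
   large power of Z/m.  The discrete logarithms of the linear characters of [G],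
   used as leaf coordinates, then embed [G]. *)
Require Import Defs.
From HB Require Import structures.
From mathcomp Require Import all_boot all_algebra all_fingroup all_solvable.
From mathcomp Require Import all_field all_character boolp.

Set Implicit Arguments.
Unset Strict Implicit.
Unset Printing Implicit Defensive.

Import GRing.Theory.
Local Open Scope ring_scope.

(** As [G] is abelian, its irreducible characters are linear, with values among the powers of one
    primitive [#|G|]-th root of unity [z]. The exponent of [z] is only defined modulo [#|G|];
    [c x i] is a representative, so additivity holds only as a congruence. *)
Lemma exists_separating_logs (G : finZmodType) :
  exists (k : nat) (c : G -> 'I_k -> int),
    (forall x y i, (#|G| %| c (x - y)%R i - (c x i - c y i))%Z) /\
    (forall x, (forall i, (#|G| %| c x i)%Z) -> x = 0).
Proof.
have G_gt0 : (0 < #|G|)%N by apply/card_gt0P; exists 0.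
have [z prim_z] := C_prim_root_exists G_gt0.
have lin (i : Iirr [set: G]) : 'chi_i \is a linear_char.
  by apply/char_abelianP/FinRing.zmod_abelian.
have logP x (i : Iirr [set: G]) : {a : 'I_#|G| | 'chi_i x = z ^+ a}.
  apply: (prim_rootP prim_z).
  rewrite -(lin_charX (lin i)) ?inE // -cardsT -(lin_char1 (lin i)).
  by rewrite (expg_cardG (G := [set: G]%G)) ?inE.
pose c x i := Posz (projT1 (logP x i)).
exists (Nirr [set: G]), c; split=> [x y i | x c_x].
  have : (projT1 (logP (x - y)%R i) + projT1 (logP y i)
          == projT1 (logP x i) %[mod #|G|])%N.
    rewrite -(eq_prim_root_expr prim_z) exprD.
    case: (logP (x - y) i) (logP y i) (logP x i) => [a ea] [b eb] [d ed] /=.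
    by rewrite -ea -eb -ed -(lin_charM (lin i)) ?inE // FinRing.zmodMgE subrK.
  by rewrite -eqz_nat -!modz_nat eqz_mod_dvd PoszD /c opprB addrA.
(* The irreducible characters have trivial common kernel, so it suffices that [x] lies in the kernel
   of each one. *)
apply/set1P; rewrite -[[set 0]]/[1 G]%g -(TI_cfker_irr [set: G]%G).
apply/bigcapP=> i _; rewrite cfkerEirr inE (lin_char1 (lin i)).
move: (c_x i); rewrite /c; case: (logP x i) => a /= ->.
by rewrite dvdzE /= (prim_order_dvd prim_z).
Qed.

Lemma mem_is_torsion (M : zmodType) (x : M) k :
  (0 < k)%N -> x *+ k = 0 -> x \in @is_torsion M.
Proof. by move=> k_gt0 xk0; apply/asboolP; exists k. Qed.

Lemma pi_cokernel_eq0 m n (L : 'M[int]_(m, n)) v :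
  (\pi_(cokernel L)%qT v == 0) = (v \in mx_image L).
Proof. by rewrite -[v in RHS]subr0 Quotient.idealrBE raddf0. Qed.

(** The map [w] need not be additive, only additive modulo the image of [L]; this lets it be built
    from integer representatives of residues. Its class is then an additive map into the torsion,
    with trivial kernel. *)
Lemma torsion_cokernel_embedding (A : zmodType) m n (L : 'M[int]_(m, n))
    (w : A -> 'cV[int]_m) k :
  (0 < k)%N ->
  (forall x y, w (x - y) - (w x - w y) \in mx_image L) ->
  (forall x, w x *+ k \in mx_image L) ->
  (forall x, w x \in mx_image L -> x = 0) ->
  exists f : {additive A -> torsion_part (cokernel L)}, injective f.
Proof.
move=> k_gt0 wB wk w0.
pose p := \pi_(cokernel L)%qT.
have tors x : p (w x) \in @is_torsion (cokernel L).
  apply: (mem_is_torsion k_gt0); apply/eqP.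
  by rewrite -raddfMn pi_cokernel_eq0.
pose f x := TorsionPart (tors x).
have fB : zmod_morphism f.
  move=> x y; apply: val_inj; rewrite raddfB /=.
  apply/eqP; rewrite -subr_eq0 -!raddfB pi_cokernel_eq0; exact: wB.
pose F := HB.pack_for {additive A -> torsion_part (cokernel L)} f
  (GRing.isZmodMorphism.Build _ _ f fB).
exists F; apply: raddf_inj => x /(congr1 val) /eqP.
by rewrite /= pi_cokernel_eq0 => /w0.
Qed.

Section UniformStar.
Variables m t : nat.
Hypotheses (m_gt0 : (0 < m)%N) (t_gt0 : (0 < t)%N).
Let n := (m * t)%N.

(** The equations read [m * t = n * 1] at the centre, which is why [n] is a multiple of [m], and
    [1 * m = m] at a leaf. *)
Let d (v : 'I_n.+1) := if v == ord0 then t else m.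
Let r (v : 'I_n.+1) := if v == ord0 then m else 1%N.

Lemma uniform_star_r_gt0 v : (0 < r v)%N.
Proof. by rewrite /r; case: ifP. Qed.

Lemma uniform_star_r_gcd : \big[gcdn/0%N]_v r v = 1%N.
Proof.
have n_gt0 : (0 < n)%N by rewrite muln_gt0 m_gt0.
apply/eqP; rewrite -dvdn1.
(* There is at least one leaf, and its label is 1. *)
by apply: (biggcdn_inf (lift ord0 (Ordinal n_gt0))).
Qed.

Lemma uniform_star_eq v : (r v * d v = \sum_u star_graph n v u * r u)%N.
Proof.
rewrite big_ord_recl /= mxE eqxx /r /d eqxx.
under eq_bigr do rewrite mxE /= muln1.
have [_|_] /= := eqVneq v ord0; last by rewrite big1 // addn0.
by rewrite sum_nat_const card_ord muln1.
Qed.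

Definition uniform_star : arithmetical_structure (star_graph n) :=
  ArithmeticalStructure uniform_star_r_gt0 uniform_star_r_gcd uniform_star_eq.

Let L := structure_matrix uniform_star.

Lemma uniform_star_mxE (y : 'cV[int]_n.+1) v :
  (L *m y) v 0 = if v == ord0 then t%:Z * y ord0 0 - \sum_i y (lift ord0 i) 0
                 else m%:Z * y v 0 - y ord0 0.
Proof.
rewrite mulmxBl mul_diag_mx !mxE /= /d big_ord_recl !mxE eqxx.
have [->|v0] /= := eqVneq v ord0.
  rewrite mul0r add0r; congr (_ - _).
  by apply: eq_bigr => i _; rewrite !mxE mul1r.
by rewrite mul1r big1 ?addr0 // => i _; rewrite !mxE (negPf v0) mul0r.
Qed.

(** A vector supported on leaves with coordinate sum zero is multiplied by [m] under [L]: the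
    central row only sees its leaf sum. *)
Lemma uniform_star_leaf_sub (a : int) (u v : 'I_n.+1) :
  u != ord0 -> v != ord0 ->
  (m%:Z * a) *: (delta_mx u 0 - delta_mx v 0) \in mx_image L.
Proof.
move=> u0 v0; apply/asboolP; exists (a *: (delta_mx u 0 - delta_mx v 0)).
apply/colP=> i; rewrite uniform_star_mxE !mxE !(eq_sym ord0).
rewrite (negPf u0) (negPf v0) !mulr0 !subr0.
have [->|i0] := eqVneq i ord0; last by rewrite mulrA.
rewrite !(eq_sym ord0) (negPf u0) (negPf v0) subr0 mulr0 sub0r.
have sum1 w : w != ord0 -> \sum_(j < n) (lift ord0 j == w)%:R = 1 :> int.
  case: (unliftP ord0 w) => [k -> _|->]; last by rewrite eqxx.
  rewrite (bigD1 k) //= eqxx big1 ?addr0 // => j jk.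
  by rewrite (inj_eq lift_inj) (negPf jk).
under eq_bigr do rewrite !mxE !andbT.
by rewrite -mulr_sumr sumrB !sum1 // subrr mulr0 oppr0.
Qed.

(** Every leaf coordinate of [L *m x] is [m] times that of [x] minus the same central term, which
    cancels in differences. *)
Lemma uniform_star_dvd (y : 'cV[int]_n.+1) (u v : 'I_n.+1) :
  u != ord0 -> v != ord0 -> y \in mx_image L -> y u 0 = 0 -> (m %| y v 0%R)%Z.
Proof.
move=> u0 v0 /asboolP[x ->]; rewrite !uniform_star_mxE (negPf u0) (negPf v0).
move=> /eqP; rewrite subr_eq0 => /eqP <-.
by rewrite -mulrBr dvdz_mulr.
Qed.

Lemma uniform_star_embedding (A : zmodType) k (c : A -> 'I_k -> int) :
  (k.+2 <= n)%N ->
  (forall x y i, (m %| c (x - y)%R i - (c x i - c y i))%Z) ->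
  (forall x, (forall i, (m %| c x i)%Z) -> x = 0) ->
  exists f : {additive A -> critical_group uniform_star}, injective f.
Proof.
move=> k_lt cB c0.
(* The shift skips the centre. Leaves [0] to [k - 1] carry the logarithms, leaf [k] balances the
   coordinate sum to zero, and leaf [k + 1] stays at zero as a reference; hence [k.+2] leaves. *)
pose leaf j : 'I_n.+1 := inord j.+1.
have leaf_neq i j : (i < k.+2)%N -> (j < k.+2)%N ->
    (leaf i == leaf j) = (i == j).
  by move=> ik jk; rewrite -val_eqE /= !inordK ?eqSS // ltnS (leq_trans _ k_lt).
have leaf0 j : (j < k.+2)%N -> leaf j != ord0.
  by move=> jk; rewrite -val_eqE /= inordK // ltnS (leq_trans jk).
pose e (j : 'I_k) : 'cV[int]_n.+1 := delta_mx (leaf j) 0 - delta_mx (leaf k) 0.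
pose w x := \sum_j c x j *: e j.
have wE x j : (j < k.+2)%N -> j != k ->
    w x (leaf j) 0 = \sum_(i < k) c x i * (j == i)%:R.
  move=> jk j_neq; rewrite summxE; apply: eq_bigr => i _.
  have ik : (i < k.+2)%N by rewrite (leq_trans (ltn_ord i)) // -addn2 leq_addr.
  by rewrite !mxE !andbT !leaf_neq // (negPf j_neq) subr0.
have e_img a j : (m %| a)%Z -> a *: e j \in mx_image L.
  case/dvdzP=> b ->; rewrite mulrC.
  apply: uniform_star_leaf_sub; rewrite leaf0 //.
  by rewrite (leq_trans (ltn_ord j)) // -addn2 leq_addr.
apply: (torsion_cokernel_embedding (w := w) m_gt0) => [x y | x | x wx].
- rewrite /w -!sumrB; apply: rpred_sum => j _.
  by rewrite -!scalerBl; apply: e_img; apply: cB.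
- rewrite /w -sumrMnl; apply: rpred_sum => j _.
  by rewrite scalerMnl; apply: e_img; rewrite -mulr_natr natz dvdz_mull.
apply: c0 => i.
have ik : (i < k.+2)%N by rewrite (leq_trans (ltn_ord i)) // -addn2 leq_addr.
have <- : w x (leaf i) 0 = c x i.
  rewrite wE ?ltn_eqF // (bigD1 i) //= eqxx mulr1 big1 ?addr0 // => j ji.
  by rewrite eq_sym val_eqE (negPf ji) mulr0.
(* Comparison with the reference leaf, where [w x] vanishes, shows that [m] divides each
   logarithm. *)
apply: (@uniform_star_dvd _ (leaf k.+1)); rewrite ?leaf0 //.
rewrite wE ?gtn_eqF // big1 // => j _.
by rewrite gtn_eqF ?mulr0 // ltnS ltnW.
Qed.

End UniformStar.

Theorem proposition19 (G : finZmodType) :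
  exists (n : nat) (s : arithmetical_structure (star_graph n))
         (f : {additive G -> critical_group s}),
    injective f.
Proof.
have G_gt0 : (0 < #|G|)%N by apply/card_gt0P; exists 0.
have [k [c [cB c0]]] := exists_separating_logs G.
(* With [t = k.+2], the number of leaves is a multiple of [#|G|] and at least [k.+2]. *)
exists (#|G| * k.+2)%N, (uniform_star G_gt0 (ltn0Sn k.+1)).
by apply: (uniform_star_embedding _ _ _ cB c0); rewrite leq_pmull.
Qed.
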